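(* Let $\kappa$ be an uncountable cardinal with $2^{<\kappa}=\kappa$, and let $X$ be a nonempty regular Hausdorff space of weight at most $\kappa$. Suppose that $\operatorname{ord}_{\kappa^+}(X)<\kappa^+$. Then the following are equivalent: (1) there is $A\in\kappa^+\text{-}\boldsymbol{\Delta}^0_{\operatorname{ord}_{\kappa^+}(X)}(X)\setminus\bigcup_{1\le\beta<\operatorname{ord}_{\kappa^+}(X)}\left(\kappa^+\text{-}\boldsymbol{\Sigma}^0_\beta(X)\cup\kappa^+\text{-}\boldsymbol{\Pi}^0_\beta(X)\right)$; (2) $X$ does not have exactly one non-isolated point. In particular, (1) holds whenever $\operatorname{ord}_{\kappa^+}(X)\neq2$.
   Context: For a topological space $X$, define by recursion on ordinals $\alpha\ge1$: $\kappa^+\text{-}\boldsymbol{\Sigma}^0_1(X)$ is the family of open sets; for $\alpha>1$, $\kappa^+\text{-}\boldsymbol{\Sigma}^0_\alpha(X)$ is the family of all unions of at most $\kappa$-many sets from $\bigcup_{1\le\beta<\alpha}\kappa^+\text{-}\boldsymbol{\Pi}^0_\beta(X)$; $\kappa^+\text{-}\boldsymbol{\Pi}^0_\alpha(X)$ is the family of complements of sets in $\kappa^+\text{-}\boldsymbol{\Sigma}^0_\alpha(X)$; $\kappa^+\text{-}\boldsymbol{\Delta}^0_\alpha(X)=\kappa^+\text{-}\boldsymbol{\Sigma}^0_\alpha(X)\cap\kappa^+\text{-}\boldsymbol{\Pi}^0_\alpha(X)$. $\kappa^+\text{-}\mathbf{Bor}(X)$ is the smallest family of subsets of $X$ containing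 the open sets and closed under complements and unions of size at most $\kappa$. Then $\operatorname{ord}_{\kappa^+}(X)=\min\{\alpha\mid\kappa^+\text{-}\boldsymbol{\Sigma}^0_\alpha(X)=\kappa^+\text{-}\mathbf{Bor}(X)\}$. *)

(* Defs.v *)
From mathcomp Require Import all_boot.
From mathcomp Require Import boolp classical_sets functions cardinality.
From mathcomp Require Import filter topology.

Set Implicit Arguments.
Unset Strict Implicit.
Unset Printing Implicit Defensive.

Local Open Scope classical_set_scope.
Local Open Scope card_scope.

(** * Ordinals *)

(* [osup f] denotes the least ordinal strictly above all the [f i].  Every
   ordinal is denoted by some term, but not by a unique one: equality of
   ordinals is [oeq], not [=]. *)
Inductive Ord : Type := osup (A : Type) (f : A -> Ord).

Fixpoint ole (a b : Ord) {struct a} : Prop :=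
  match a, b with
  | osup A f, osup B g => forall i : A, exists j : B, ole (f i) (g j)
  end.

Definition olt (a b : Ord) : Prop :=
  match b with osup B g => exists j : B, ole a (g j) end.

Definition oeq (a b : Ord) : Prop := ole a b /\ ole b a.

Definition ozero : Ord := osup (fun v : False => match v with end).
Definition osucc (a : Ord) : Ord := osup (fun _ : unit => a).
Definition oone : Ord := osucc ozero.
Definition otwo : Ord := osucc oone.

Lemma ole_refl a : ole a a.
Proof. by elim: a => A f IH /= i; exists i; exact: IH. Qed.

Lemma ole_trans a b c : ole a b -> ole b c -> ole a c.
Proof.
elim: a b c => A f IH [B g] [C h] /= fg gh i.
have [j fgj] := fg i; have [k ghk] := gh j.
by exists k; exact: IH fgj ghk.
Qed.

Lemma ole_olt_trans a b c : ole a b -> olt b c -> olt a c.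
Proof. by case: c => C h ab [k bk]; exists k; exact: ole_trans ab bk. Qed.

Lemma olt_ole_trans a b c : olt a b -> ole b c -> olt a c.
Proof.
case: b c => B g [C h] [j aj] gh; have [k gk] := gh j.
by exists k; exact: ole_trans aj gk.
Qed.

Lemma oleP a b : ole a b <-> forall c, olt c a -> olt c b.
Proof.
split=> [ab c ca|]; first exact: olt_ole_trans ca ab.
case: a b => A f [B g] h i.
by apply: (h (f i)); exists i; exact: ole_refl.
Qed.

Lemma olt_wf : well_founded olt.
Proof.
suff acc a b : ole b a -> Acc olt b by move=> a; exact: (acc a a (ole_refl a)).
elim: a b => A f IH b ba; constructor=> c cb.
by have [i ci] := olt_ole_trans cb ba; exact: IH ci.
Qed.

Lemma oltW a b : olt a b -> ole a b.
Proof.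
elim: a b => A f IH [B g] [j fj] i; exists j; apply: IH.
by apply: olt_ole_trans fj; exists i; exact: ole_refl.
Qed.

Lemma oltNge a b : olt a b <-> ~ ole b a.
Proof.
split=> [ab ba|].
  elim/(well_founded_induction olt_wf): a b ab ba => a IH b ab ba.
  by have aa := olt_ole_trans ab ba; exact: (IH a aa a aa (ole_refl a)).
elim: a b => A f IH [B g] /existsNP[j] /forallNP nj; exists j.
apply/oleP => c [i ci]; apply: (ole_olt_trans ci).
exact: IH (nj i).
Qed.

(** * Cardinals: a cardinal is given by a type [K] of that cardinality. *)

Definition card_ltT (L K : Type) : Prop :=
  [set: L] #<= [set: K] /\ ~ ([set: K] #<= [set: L]).

(* [M] has cardinality 2^{<K}, the supremum of the 2^L for L < K. *)
Definition is_weak_power (K M : Type) : Prop :=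
  (forall L : Type, card_ltT L K -> [set: set L] #<= [set: M]) /\
  (forall N : Type,
     (forall L : Type, card_ltT L K -> [set: set L] #<= [set: N]) ->
     [set: M] #<= [set: N]).

Fixpoint acc_rank (K : Type) (R : K -> K -> Prop) (x : K) (h : Acc R x) : Ord :=
  osup (fun y : {y : K | R y x} => acc_rank (Acc_inv h (proj2_sig y))).

Definition wf_rank (K : Type) (R : K -> K -> Prop) (h : well_founded R) : Ord :=
  osup (fun x : K => acc_rank (h x)).

(* The ordinal K^+: the supremum of the successors of the ranks of all
   well-founded relations on [K] (Hartogs), for [K] nonempty. *)
Definition kplus (K : Type) : Ord :=
  osup (fun R : {R : K -> K -> Prop | well_founded R} => wf_rank (proj2_sig R)).

Lemma acc_rankE (K : Type) (R : K -> K -> Prop) x (h : Acc R x) b :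
  olt b (acc_rank h) <-> exists y (Ryx : R y x), ole b (acc_rank (Acc_inv h Ryx)).
Proof.
case: h => h /=; split=> [[[y Ryx] /= ?]|[y [Ryx ?]]]; first by exists y, Ryx.
by exists (exist _ y Ryx).
Qed.

Lemma acc_rank_irr (K : Type) (R : K -> K -> Prop) x (h1 h2 : Acc R x) :
  acc_rank h1 = acc_rank h2.
Proof. by rewrite (Prop_irrelevance h1 h2). Qed.

(* K^+ is the set of ordinals having at most K predecessors. *)
Lemma olt_kplusP (K : Type) (a : Ord) : inhabited K ->
  olt a (kplus K) <->
  exists e : K -> Ord, forall b, olt b a -> exists k, oeq b (e k).
Proof.
move=> [k0]; split=> [[[R wfR] /= aR]|[e ecov]].
  exists (fun k => acc_rank (wfR k)) => b ba.
  have rankP k : ole b (acc_rank (wfR k)) ->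
      exists k', oeq b (acc_rank (wfR k')).
    elim/(well_founded_induction wfR): k => k IH bk.
    have [kb|/oltNge] := pselect (ole (acc_rank (wfR k)) b); first by exists k.
    move=> /acc_rankE[y [Ryk by_]]; apply: (IH y Ryk).
    by rewrite (acc_rank_irr _ (Acc_inv (wfR k) Ryk)).
  by have [k bk] := olt_ole_trans ba aR; exact: rankP bk.
have wfe : well_founded (fun k k' => olt (e k) (e k')).
  move=> k; have [o ek] : exists o, e k = o by exists (e k).
  elim/(well_founded_induction olt_wf): o k ek => o IH k ek.
  by constructor=> l lk; apply: (IH (e l)) => //; rewrite -ek.
exists (exist _ _ wfe) => /=; apply/oleP => b ba.
have [k [bk kb]] := ecov b ba; exists k.
elim/(well_founded_induction olt_wf): b ba k bk kb => b IH ba k bk kb.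
apply/oleP => c cb; apply/acc_rankE.
have ca := olt_ole_trans cb (oltW ba).
have [l [cl lc]] := ecov c ca.
have lk : olt (e l) (e k).
  by apply: ole_olt_trans lc _; exact: olt_ole_trans cb bk.
exists l, lk; rewrite (acc_rank_irr _ (wfe l)).
exact: (IH c cb ca l cl lc).
Qed.

(** * The kappa^+-Borel hierarchy *)

Section hierarchy.
Variables (K : Type) (X : topologicalType).
Implicit Types (a b : Ord) (A : set X) (F : set (set X)).

(* Recursion on the ordinal, presented as an inductive predicate: since [olt] is
   well-founded, [kSigma] is determined for ordinals at least 1 by the
   equations [kSigma_one] and [kSigma_gt1]. *)
Inductive kSigma : Ord -> set X -> Prop :=
| kSigma_open a A : oeq a oone -> open A -> kSigma a A
| kSigma_union a F : olt oone a -> F #<= [set: K] ->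
    (forall A, F A -> exists b, [/\ ole oone b, olt b a & kSigma b (~` A)]) ->
    kSigma a (\bigcup_(A in F) A).

Definition kPi a : set (set X) := [set A | kSigma a (~` A)].

Definition kDelta a : set (set X) := kSigma a `&` kPi a.

Lemma kSigmaP a A : kSigma a A <->
  oeq a oone /\ open A \/
  olt oone a /\ exists F, [/\ F #<= [set: K],
    F `<=` \bigcup_(b in [set b | ole oone b /\ olt b a]) kPi b &
    A = \bigcup_(B in F) B].
Proof.
split.
  case=> {}a; first by left.
  move=> F a1 FK Fa; right; split=> //; exists F; split=> // B FB.
  by have [b [? ? ?]] := Fa _ FB; exists b.
case=> [[? ?]|[a1 [F [FK Fa ->]]]]; first exact: kSigma_open.
by apply: kSigma_union => // B /Fa[b [? ?] ?]; exists b.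
Qed.

Lemma kSigma_one : kSigma oone = open.
Proof.
apply/seteqP; split=> A; last by apply: kSigma_open; split; exact: ole_refl.
by move=> /kSigmaP[[]//|[/oltNge]]; case; exact: ole_refl.
Qed.

Lemma kSigma_gt1 a : olt oone a ->
  kSigma a = [set A | exists F, [/\ F #<= [set: K],
    F `<=` \bigcup_(b in [set b | ole oone b /\ olt b a]) kPi b &
    A = \bigcup_(B in F) B]].
Proof.
move=> a1; apply/seteqP; split=> A; last by move=> ?; apply/kSigmaP; right.
by move=> /kSigmaP[[[aa _] _]|[]//]; move/oltNge: a1.
Qed.

Definition kalgebra (M : set (set X)) : Prop :=
  (forall A, M A -> M (~` A)) /\
  (forall F, F `<=` M -> F #<= [set: K] -> M (\bigcup_(A in F) A)).

Definition kBor : set (set X) := smallest kalgebra open.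

(* [a] is ord_{kappa^+}(X), which determines it up to [oeq]. *)
Definition is_kord a : Prop :=
  [/\ ole oone a, kSigma a = kBor &
      forall b, ole oone b -> kSigma b = kBor -> ole a b].

Definition weight_le : Prop :=
  exists2 B : set (set X), basis B & B #<= [set: K].

Definition new_kDelta a : Prop :=
  exists A, kDelta a A /\
    ~ (\bigcup_(b in [set b | ole oone b /\ olt b a]) (kSigma b `|` kPi b)) A.

End hierarchy.

(* Main.v *)
Require Import Defs.
From mathcomp Require Import all_boot.
From mathcomp Require Import boolp classical_sets functions cardinality.
From mathcomp Require Import filter topology.
From mathcomp Require Import wochoice.

(** Call a Borel piece [D] of [X] simple at [b] if all its Borel subsets are
    [Sigma b]; then [a] is the least level at which [X] is simple.

    If [a = g + 1] with [g >= 2], let [U0] be the largest open set simple at [g].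
    Were its complement empty or a single point, [X] would be simple at [g].  So
    two points outside [U0] have disjoint neighbourhoods that are not simple at [g];
    a set which is not [Sigma g] in the first one together with a set which is not
    [Pi g] in the second one is new ([new_kDelta_succ]).

    If [a] is a limit, a new set has to escape from all levels below [a] at once.
    The key is that every [Sigma 3] piece [D] is tame: there is one Borel
    subset of [D] which is in [Sigma b], for [b >= 3], only if [D] is simple at [b]
    ([simple_tame]).  A union of at most [K] disjoint tame pieces is tame
    ([tame_bigcup]).  By induction on the level [lam] at which [D] is simple, it
    can be assumed that the [Sigma 3] subsets of [D] that are not tame are simple
    at no level below [lam].  If there are [K] disjoint ones, then, as [lam] has
    at most [K] predecessors, a different level can be escaped in each of them, so
    [D] is tame ([tame_antichain]).  If not, look at the binary tree of height [K]
    given by a base of [X]: each of its cells is determined by a point and a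
    level, and is the set of points that belong to the same basic open sets up to
    that level.  Since [2^{<K} = K] there are only [K] cells.  The maximal tame
    cells are disjoint, and the points that lie in no tame cell are branches such
    that others leave each of them at fewer than [K] levels only.  A branch is
    coded by its turns at these levels, so that, again by [2^{<K} = K], there are
    at most [K] such points ([cell_dichotomy]).  So [D] is a union of at most [K]
    disjoint tame cells and singletons.

    There remain [a = 1], where every set is new, and [a = 2], where new means
    neither open nor closed: two non-isolated points provide such a set
    ([new_kDelta_two]), a single one does not ([not_new_kDelta]), and without any
    [X] is discrete and [a = 1]. *)

Set Implicit Arguments.
Unset Strict Implicit.
Unset Printing Implicit Defensive.

Local Open Scope classical_set_scope.
Local Open Scope card_scope.

(** * Cardinals and well-orderings *)

Lemma card_le_of_inj T U (A : set T) (B : set U) (f : T -> U) :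
  (forall x, A x -> B (f x)) ->
  (forall x y, A x -> A y -> f x = f y -> x = y) -> A #<= B.
Proof.
move=> fAB finj.
have /injfunPex[g] : exists2 f : T -> U, set_fun A B f & set_inj A f.
  by exists f => // x y /set_mem Ax /set_mem Ay; exact: finj.
exact: inj_card_le g.
Qed.

Lemma card_le_inj T U (A : set T) (B : set U) : A #<= B -> B !=set0 ->
  exists2 f : T -> U, (forall x, A x -> B (f x)) &
    (forall x y, A x -> A y -> f x = f y -> x = y).
Proof.
elim/Ppointed: U => U in B *; first by move=> _ [x]; case: (no x).
move=> /pcard_leP/injfunPex[f fAB finj] _; exists f => // x y Ax Ay.
by apply: finj; exact: mem_set.
Qed.

Lemma card_le_surj T U (A : set T) (B : set U) (f : T -> U) :
  B `<=` f @` A -> B #<= A.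
Proof. by move=> /subset_card_le/card_le_trans; apply; exact: card_image_le. Qed.

Definition strict_wo T (lt : T -> T -> Prop) := [/\ well_founded lt,
  forall x y z, lt x y -> lt y z -> lt x z &
  forall x y, [\/ lt x y, x = y | lt y x]].

Lemma strict_wo_exists T : exists lt : T -> T -> Prop, strict_wo lt.
Proof.
have [R Rwo] := @well_ordering_principle {classic T}.
have Rch : wo_chain R predT by move=> A _; exact: Rwo.
have anti (x y : T) : R x y -> R y x -> x = y.
  by move=> xy yx; apply: (wo_chain_antisymmetric Rch) => //; rewrite xy.
have tot (x y : T) : R x y || R y x by exact: (wo_chainW Rch).
have least (A : set T) : A !=set0 -> exists2 z, A z & forall x, A x -> R z x.
  move=> [x Ax]; have [|z [[Az zA] _]] := Rwo [pred x : {classic T} | `[< A x >]].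
    by exists x; exact/asboolP.
  by exists z => [|y Ay]; [exact/asboolP|apply: zA; exact/asboolP].
exists (fun x y => R x y /\ x <> y); split.
- move=> x; apply: contrapT => nx.
  have [//|z nz zmin] := least (fun x => ~ Acc (fun x y => R x y /\ x <> y) x).
    by exists x.
  apply: nz; constructor=> y [yz neq]; apply: contrapT => ny.
  by apply: neq; apply: anti => //; exact: zmin.
- move=> x y z [xy nxy] [yz nyz].
  have [|w wxyz wmin] := least [set u | u = x \/ u = y \/ u = z].
    by exists x; left.
  have Rxz : R x z.
    case: wxyz wmin => [->|[->|->]] wmin; first by apply: wmin; right; right.
      by case: nxy; apply: anti => //; apply: wmin; left.
    by case: nyz; apply: anti => //; apply: wmin; right; left.
  by split=> // xz; apply: nxy; apply: anti; rewrite // xz.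
- move=> x y; have [->|xy] := pselect (x = y); first by constructor 2.
  have /orP[Rxy|Ryx] := tot x y; first by constructor 1.
  by constructor 3; split=> // yx; apply: xy.
Qed.

Lemma wf_least T (lt : T -> T -> Prop) (P : T -> Prop) : well_founded lt ->
  (exists x, P x) -> exists2 x, P x & forall y, lt y x -> ~ P y.
Proof.
move=> wf [x Px]; apply: contrapT => nl.
elim/(well_founded_induction wf): x Px => x IH Px.
by apply: nl; exists x => // y /IH.
Qed.

(** ** Collapsing a well-founded relation *)

Section collapse.
Variables (W T : Type) (ltW : W -> W -> Prop) (ltT : T -> T -> Prop).
Hypotheses (wfW : well_founded ltW) (wfT : well_founded ltT) (t0 : T).
Variable B : set T.

Let least_spec (P : set T) : exists t, P !=set0 -> P t /\ forall u, ltT u t -> ~ P u.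
Proof.
have [P0|P0] := pselect (P !=set0); last by exists t0.
by have [t Pt tmin] := wf_least wfT P0; exists t.
Qed.

Let least P := sval (cid (least_spec P)).

(** The Mostowski-type recursion on [A]: each point of [W] is sent to the least
    element of [B] that is not yet the image of a smaller point of [A]. *)
Definition collapse (A : set W) : W -> T :=
  Fix wfW (fun=> T) (fun w rec =>
    least [set t | B t /\ forall v (vw : ltW v w), A v -> rec v vw <> t]).

Let fresh A w := [set t | B t /\ forall v, ltW v w -> A v -> collapse A v <> t].

Let collapseE A w : collapse A w = least (fresh A w).
Proof.
rewrite /collapse Fix_eq //= => x f g fg.
by congr least; apply/seteqP; split=> t [Bt ft]; split=> // v vx; have := ft v vx;
  rewrite fg.
Qed.

Let freshP A w : ~ (B #<= A `&` [set v | ltW v w]) ->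
  fresh A w (collapse A w) /\ forall u, ltT u (collapse A w) -> ~ fresh A w u.
Proof.
move=> small; rewrite collapseE.
apply: (svalP (cid (least_spec (fresh A w)))).
apply: contrapT => none; apply: small.
apply: (card_le_surj (f := collapse A)) => t Bt; apply: contrapT => nt.
by apply: none; exists t; split=> // v vw Av vt; apply: nt; exists v.
Qed.

Lemma collapse_in A w : ~ (B #<= A `&` [set v | ltW v w]) -> B (collapse A w).
Proof. by case/freshP=> -[]. Qed.

(** By minimality of the values: [collapse] maps [A] onto an initial segment of
    [B]. *)
Lemma collapse_down A w t : ~ (B #<= A `&` [set v | ltW v w]) ->
  B t -> ltT t (collapse A w) -> exists2 v, A v & collapse A v = t.
Proof.
move=> /freshP[_ +] Bt tw => /(_ _ tw) nt; apply: contrapT => none; apply: nt.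
by split=> // v vw Av vt; apply: none; exists v.
Qed.

Lemma collapse_inj A : (forall u v, [\/ ltW u v, u = v | ltW v u]) ->
  (forall w, A w -> ~ (B #<= A `&` [set v | ltW v w])) ->
  forall u v, A u -> A v -> collapse A u = collapse A v -> u = v.
Proof.
move=> tri small u v Au Av uv; have [uv'|//|vu'] := tri u v.
- by have [[_ /(_ u uv' Au)]] := freshP (small v Av).
- by have [[_ /(_ v vu' Av)]] := freshP (small u Au); rewrite uv.
Qed.

Lemma collapse_local A A' w : (forall u v w, ltW u v -> ltW v w -> ltW u w) ->
  (forall v, ltW v w -> A v <-> A' v) -> collapse A w = collapse A' w.
Proof.
move=> tr; elim/(well_founded_induction wfW): w => w IH AA'.
rewrite !collapseE; congr least; apply/seteqP; split=> t [Bt ft]; split=> // v vw Av.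
- rewrite -IH//; last by move=> u uv; apply: AA'; exact: tr uv vw.
  by apply: ft => //; apply/AA'.
- rewrite IH//; last by move=> u uv; apply: AA'; exact: tr uv vw.
  by apply: ft => //; apply/AA'.
Qed.

End collapse.

(** Inside [A * A] there is room for one copy of [A] (a column) and one more
    point, as soon as [A] has two elements. *)
Lemma setU1_card_le T (A : set T) c : A `*` A #<= A -> infinite_set A ->
  A `|` [set c] #<= A.
Proof.
move=> AA Ainf.
have [a Aa] := infinite_setN0 Ainf.
have [b [Ab ba]] : exists b, A b /\ b <> a.
  apply: contrapT => nb; apply: Ainf.
  apply: (@sub_finite_set _ _ [set a]) => // x Ax /=.
  by apply: contrapT => xa; apply: nb; exists x.
apply: card_le_trans AA.
apply: (card_le_of_inj (f := fun x => if pselect (A x) then (x, a) else (a, b))).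
  by move=> x _; case: pselect.
have notA x : (A `|` [set c]) x -> ~ A x -> x = c by case.
move=> x y Ax Ay; case: pselect => xA; case: pselect => yA /=.
- by case.
- by move=> [_ /esym].
- by move=> [_ /ba].
- by rewrite (notA x)// (notA y).
Qed.

(** ** Squares of infinite sets *)

Section square.
Variables (T : Type) (lt : T -> T -> Prop).
Hypothesis wo : strict_wo lt.

Let wf : well_founded lt. Proof. by case: wo. Qed.
Let tri x y : [\/ lt x y, x = y | lt y x]. Proof. by case: wo => _ _; apply. Qed.
Let tr x y z : lt x y -> lt y z -> lt x z.
Proof. by case: wo => _ + _; apply. Qed.

Let le x y := lt x y \/ x = y.
(* the maximum of the two coordinates *)
Let mx (p : T * T) := if pselect (lt p.1 p.2) then p.2 else p.1.

Let mx_ge p : le p.1 (mx p) /\ le p.2 (mx p).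
Proof.
rewrite /mx; case: pselect => [?|n] /=; split; try by [left|right].
by have [//|->|?] := tri p.1 p.2; [right|left].
Qed.

(* Goedel's well-ordering of pairs: by maximum, then lexicographically.  The
   predecessors of [p] all lie in the square of the segment up to [mx p]. *)
Let lt2 (p q : T * T) := lt (mx p) (mx q) \/
  mx p = mx q /\ (lt p.1 q.1 \/ p.1 = q.1 /\ lt p.2 q.2).

Let wf2 : well_founded lt2.
Proof.
suff H m a b : mx (a, b) = m -> Acc lt2 (a, b) by case=> a b; exact: (H _ a b erefl).
elim/(well_founded_induction wf): m a b => m IHm a.
elim/(well_founded_induction wf): a => a IHa b.
elim/(well_founded_induction wf): b => b IHb mab.
constructor=> -[c d] [|[e []]].
- by rewrite mab => cdm; apply: (IHm _ cdm).
- by move=> /= ca; apply: (IHa _ ca); rewrite e.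
- by move=> /= [ca db]; rewrite ca in e *; apply: (IHb _ db); rewrite e.
Qed.

Let tri2 p q : [\/ lt2 p q, p = q | lt2 q p].
Proof.
case: p q => a b [c d].
have [m|m|m] := tri (mx (a, b)) (mx (c, d));
  [by constructor 1; left| |by constructor 3; left].
have [ac|ac|ac] := tri a c;
  [by constructor 1; right; split=> //; left|
  |by constructor 3; right; split=> //; left].
rewrite ac in m *.
have [bd|->|bd] := tri b d;
  [by constructor 1; right; split=> //; right|by constructor 2|
   by constructor 3; right; split=> //; right].
Qed.

(* Either [S] injects into one of its proper segments, where the induction
   hypothesis applies, or [S] has initial order type and then collapses Goedel's
   order on [S * S] into [S]. *)
Let square_step (S : set T) :
  (forall c, S c -> forall S', S' `<=` [set j | lt j c] ->
     infinite_set S' -> S' `*` S' #<= S') ->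
  infinite_set S -> S `*` S #<= S.
Proof.
move=> IH Sinf.
have [[c [Sc Sle]]|noc] := pselect (exists c, S c /\ S #<= S `&` [set j | lt j c]).
  have S'inf : infinite_set (S `&` [set j | lt j c]).
    by apply: contra_not Sinf; exact: card_le_finite.
  have S'sq := IH c Sc _ (@subIsetr _ _ _) S'inf.
  have [f fS finj] := card_le_inj Sle (infinite_setN0 S'inf).
  apply: card_le_trans (subset_card_le (@subIsetl _ S [set j | lt j c])).
  apply: card_le_trans S'sq.
  apply: (card_le_of_inj (f := fun p => (f p.1, f p.2))).
    by move=> [x y] [/= Sx Sy]; split; exact: fS.
  by move=> [x y] [z t] /= [Sx Sy] [Sz St] [] /finj-> // /finj->.
have [s0 Ss0] := infinite_setN0 Sinf.
have small p : (S `*` S) p -> ~ (S #<= (S `*` S) `&` [set q | lt2 q p]).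
  move=> Sp Sle; set c := mx p.
  have Sc : S c by rewrite /c /mx; case: pselect; case: Sp.
  pose L := S `&` [set j | lt j c].
  have Lc q : (S `*` S) q -> lt2 q p -> ((L `|` [set c]) `*` (L `|` [set c])) q.
    move=> [S1 S2] qp; have qc : le (mx q) c by case: qp => [?|[? _]]; [left|right].
    have [q1 q2] := mx_ge q.
    have lec x : S x -> le x (mx q) -> (L `|` [set c]) x.
      move=> Sx xq; have [xc|xc] : le x c.
      - case: xq qc => [xq|->//] [qc|<-]; left=> //; exact: tr xq qc.
      - by left.
      - by right.
    by split; apply: lec.
  have {}Sle : S #<= (L `|` [set c]) `*` (L `|` [set c]).
    by apply: card_le_trans Sle (subset_card_le _) => q [Sq]; exact: Lc.
  have [Lfin|Linf] := pselect (finite_set L).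
    by apply: Sinf; apply: card_le_finite Sle _; apply: finite_setX;
      rewrite finite_setU; split.
  have LL := IH c Sc L (@subIsetr _ _ _) Linf.
  apply: noc; exists c; split=> //; apply: card_le_trans Sle (card_le_trans _ LL).
  have [f fL finj] := card_le_inj (setU1_card_le c LL Linf) (infinite_setN0 Linf).
  apply: (card_le_of_inj (f := fun p => (f p.1, f p.2))).
    by move=> [x y] [/= Sx Sy]; split; exact: fL.
  by move=> [x y] [z t] /= [Sx Sy] [Sz St] [] /finj-> // /finj->.
apply: (card_le_of_inj (f := collapse wf2 wf s0 S (S `*` S))).
  by move=> p /small; exact: collapse_in.
by apply: collapse_inj; [exact: tri2|exact: small].
Qed.

Lemma setX_self_card_le (S : set T) : infinite_set S -> S `*` S #<= S.
Proof.
apply: square_step => c _; elim/(well_founded_induction wf): c => c IHc S' S'c.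
by apply: square_step => d /S'c /IHc.
Qed.

End square.


(** ** The cardinal of an infinite type [K] *)

Section kappa.
Variable (K : Type).
Hypothesis Kinf : infinite_set [set: K].

Lemma countable_leK T (A : set T) : countable A -> A #<= [set: K].
Proof. by move=> /card_le_trans; apply; exact/infiniteP. Qed.

Lemma bigcup_leK I T (D : set I) (F : I -> set T) : D #<= [set: K] ->
  (forall i, D i -> F i #<= [set: K]) -> \bigcup_(i in D) F i #<= [set: K].
Proof.
have Kne := infinite_setN0 Kinf; have [k0 _] := Kne.
have [lt wo] := strict_wo_exists K.
have KK : [set: K * K] #<= [set: K] by rewrite -setXTT; apply: setX_self_card_le wo _ Kinf.
move=> DK FK; apply: card_le_trans KK.
have [[i0 Di0]|/nonemptyPn D0] := pselect (D !=set0); last first.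
  by rewrite D0 bigcup_set0; exact: card_ge0.
have [g _ ginj] := card_le_inj DK Kne.
have /choice[f finj] : forall i, exists f : T -> K,
    D i -> forall x y, F i x -> F i y -> f x = f y -> x = y.
  move=> i; have [Di|nDi] := pselect (D i); last by exists (fun=> k0).
  by have [f _ finj] := card_le_inj (FK i Di) Kne; exists f.
have /choice[h hP] : forall x, exists i, (\bigcup_(i in D) F i) x -> D i /\ F i x.
  move=> x; have [[i Di Fix]|nx] := pselect ((\bigcup_(i in D) F i) x).
    by exists i.
  by exists i0 => /nx.
apply: (card_le_of_inj (f := fun x => (g (h x), f (h x) x))) => // x y /hP[Dx Fx] /hP[Dy Fy].
move=> [/ginj e]; rewrite -e// in Fy *; exact: finj.
Qed.

Lemma setU_leK T (A B : set T) : A #<= [set: K] -> B #<= [set: K] ->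
  A `|` B #<= [set: K].
Proof.
move=> AK BK; rewrite -bigcup2E; apply: bigcup_leK.
  exact: countable_leK.
by move=> [|[|n]] _ //=; exact: card_ge0.
Qed.

(** [K] is re-ordered through an injection into the least segment that is as
    large as [K].  The injection is made to avoid the top [k] of that segment, so
    that even the segments closed on the right become smaller than [K]. *)
Lemma initial_wo : exists2 lt : K -> K -> Prop, strict_wo lt &
  forall k, ~ ([set: K] #<= [set j | ~ lt k j]).
Proof.
have [lt wo] := strict_wo_exists K; have [wf tr tri] := wo.
have [[k Kk]|nk] := pselect (exists k, [set: K] #<= [set j | ~ lt k j]); last first.
  by exists lt => // k Kk; apply: nk; exists k.
have [|{Kk} {}k Kk kmin] :=
  @wf_least _ _ (fun k => is_true ([set: K] #<= [set j | ~ lt k j])) wf.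
  by exists k.
have optK : [set: option K] #<= [set: K].
  have -> : [set: option K] = some @` [set: K] `|` [set None].
    by apply/seteqP; split=> -[x|] // _; [left; exists x|right].
  by apply: setU_leK; [exact: card_image_le|exact: countable_leK].
have kk : [set j | ~ lt k j] k by move/kmin.
have [f fk finj] : exists2 f : K -> K, forall x, lt (f x) k & injective f.
  have [g gk ginj] := card_le_inj (card_le_trans optK Kk) (ex_intro _ k kk).
  have [o oP] : exists o, forall x, g x = k -> x = o.
    have [[o ok]|no] := pselect (exists o, g o = k).
      by exists o => x xk; apply: ginj => //; rewrite xk.
    by exists None => x xk; case: no; exists x.
  have [h hinj ho] : exists2 h : K -> option K, injective h & forall x, h x <> o.
    case: o {oP} => [p|]; last by exists some => // x y [].
    exists (fun x => if pselect (x = p) then None else Some x).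
      by move=> x y; case: pselect => xp; case: pselect => yp //=; [rewrite xp yp|case].
    by move=> x; case: pselect => //= nx [].
  exists (g \o h) => [x|x y /ginj e]; last by apply: hinj; exact: e.
  have [//|e|] := tri (g (h x)) k; first by case: (ho x); exact: oP.
  by move/(gk (h x) I).
exists (fun x y => lt (f x) (f y)).
- split=> [x|x y z|x y]; last 2 first.
  + exact: tr.
  + by have [|/finj|] := tri (f x) (f y); [constructor 1|constructor 2|constructor 3].
  + move: {2}(f x) (erefl (f x)) => z; elim/(well_founded_induction wf): z x => z IH x fx.
    by constructor=> y; rewrite fx => yz; apply: (IH (f y)).
- move=> l Kl; apply: (kmin (f l) (fk l)); apply: card_le_trans Kl _.
  by apply: (card_le_of_inj (f := f)) => // x y _ _; exact: finj.
Qed.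

Hypothesis Kpow : is_weak_power K K.

Lemma subsets_leK (A : set K) : ~ ([set: K] #<= A) -> [set B | B `<=` A] #<= [set: K].
Proof.
move=> KA; have [pow _] := Kpow.
have LA : [set: {x | A x}] #<= A.
  apply: (card_le_of_inj (f := sval)) => [[]//|[x Sx] [y Sy] _ _ /= xy]; exact: eq_exist.
have /pow : card_ltT {x | A x} K.
  split; first exact: card_le_trans LA (card_leT _).
  by move=> /card_le_trans/(_ LA).
apply: card_le_trans.
apply: (card_le_of_inj (f := fun B : set K => [set x : {x | A x} | B (sval x)])) => //.
move=> B C /= BA CA e; apply/seteqP; split=> x.
  move=> Bx; suff : [set x : {x | A x} | B (sval x)] (exist _ x (BA x Bx)) by rewrite e.
  by [].
move=> Cx; suff : [set x : {x | A x} | C (sval x)] (exist _ x (CA x Cx)) by rewrite -e.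
by [].
Qed.

End kappa.

(** * A tree of cells *)

Section tree.
Variables (K X : Type) (lt : K -> K -> Prop) (B : K -> set X).
Hypothesis Kinf : infinite_set [set: K].
Hypothesis Kpow : is_weak_power K K.
Hypothesis wo : strict_wo lt.
Hypothesis lt_initial : forall k, ~ ([set: K] #<= [set j | ~ lt k j]).
Hypothesis B_sep : forall x y, (forall j, B j x <-> B j y) -> x = y.

Let wf : well_founded lt. Proof. by case: wo. Qed.
Let tri x y : [\/ lt x y, x = y | lt y x]. Proof. by case: wo => _ _; apply. Qed.
Let tr x y z : lt x y -> lt y z -> lt x z.
Proof. by case: wo => _ + _; apply. Qed.

(** Reading [x] as the [0-1] sequence [j |-> B j x], [cell x k] is the node of
    the binary tree of height [K] through which the branch [x] passes at
    level [k]. *)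
Definition cell x k := [set y | forall j, ~ lt k j -> (B j y <-> B j x)].

Let ltxx k : ~ lt k k.
Proof. by elim/(well_founded_induction wf): k => k IH kk; exact: (IH k kk kk). Qed.

Let ltNlt j k : lt j k -> ~ lt k j.
Proof. by move=> jk kj; exact: ltxx (tr jk kj). Qed.

Let cell_eq x k z j : cell x k z -> ~ lt k j -> cell z j = cell x j.
Proof.
move=> zx kj.
have e i : ~ lt j i -> (B i z <-> B i x).
  move=> ji; apply: zx => ki; have [jk|jk|//] := tri j k; last first.
    by rewrite jk in ji.
  by apply: ji; exact: tr ki.
by apply/seteqP; split=> y yz i ji; rewrite (yz i ji) e.
Qed.

(** A cell at level [k] is given by [k] and a subset of a segment of cardinality
    less than [K]; there are at most [2^{<K} = K] of these. *)
Lemma cells_leK : [set cell p.1 p.2 | p in [set: X * K]] #<= [set: K].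
Proof.
pose c (k : K) (T : set K) := [set y | forall j, ~ lt k j -> (B j y <-> T j)].
pose U := \bigcup_(k in [set: K]) (c k @` [set T | T `<=` [set j | ~ lt k j]]).
apply: (@card_le_trans _ _ _ U).
  apply: subset_card_le => _ [[x k] _ <-]; exists k => //=.
  exists [set j | ~ lt k j /\ B j x]; first by move=> j [].
  apply/seteqP; split=> y yx j kj; first by rewrite (yx j kj); split=> [[]|].
  by rewrite (yx j kj); split=> [|[]].
apply: (bigcup_leK Kinf) => // k _.
by apply: card_le_trans (card_image_le _ _) (subsets_leK _ _).
Qed.

(** Cut the tree at the first cells that satisfy [P].  What remains of [D] is the
    set [G] of the branches that never meet [P].  At every level where another
    branch of [G] leaves a branch [x] of [G], the cell of that other branch just
    after it left is one of a disjoint family of cells not in [P].  So either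
    some [x] in [G] has [K] such levels, or each has fewer.  In the second case,
    [x] can be recovered from the sequence of its turns at these levels, a
    bounded subset of [K] after the levels are collapsed to an initial segment;
    hence [G] has at most [2^{<K} = K] points and can be cut into singletons. *)
Lemma cell_dichotomy (P : set (set X)) (D : set X) :
  (exists W : K -> set X,
    [/\ forall k, exists x l, W k = D `&` cell x l,
        forall k, ~ P (W k) & forall j k, W j `&` W k !=set0 -> j = k]) \/
  (exists F : set (set X), [/\ F #<= [set: K],
     forall C, F C -> P C /\ (exists x l, C = D `&` cell x l) \/ exists x, C = [set x],
     forall C C', F C -> F C' -> C `&` C' !=set0 -> C = C' &
     D = \bigcup_(C in F) C]).
Proof.
have [k0 _] := infinite_setN0 Kinf.
pose G := [set x | D x /\ forall k, ~ P (D `&` cell x k)].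
(* [S x] is the set of levels at which some branch of [G] leaves [x]. *)
pose S x := [set k | exists2 y, G y & (forall j, lt j k -> (B j y <-> B j x)) /\
  ~ (B k y <-> B k x)].
have [[x [Gx KS]]|nS] := pselect (exists x, G x /\ [set: K] #<= S x).
  left; have SN0 : S x !=set0.
    apply: contrapT => /nonemptyPn S0; move: KS; rewrite S0 => /card_le0P K0.
    by have : [set: K] k0 by []; rewrite K0.
  have [f fS finj] := card_le_inj KS SN0.
  have /choice[y yP] : forall k, exists y, G y /\
      (forall j, lt j (f k) -> (B j y <-> B j x)) /\ ~ (B (f k) y <-> B (f k) x).
    by move=> k; have [y Gy ?] := fS k I; exists y.
  exists (fun k => D `&` cell (y k) (f k)); split.
  - by move=> k; exists (y k), (f k).
  - by move=> k; have [[_ nP] _] := yP k; exact: nP.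
  - suff H j k z : cell (y j) (f j) z -> cell (y k) (f k) z -> ~ lt (f j) (f k).
      move=> j k [z [[_ zj] [_ zk]]]; apply: finj => //.
      by have [/(H _ _ _ zj zk)|//|/(H _ _ _ zk zj)] := tri (f j) (f k).
    move=> zj zk jk; have [_ [_ nj]] := yP j; have [_ [kx _]] := yP k; apply: nj.
    by rewrite -(kx _ jk) -(zk _ (ltNlt jk)) (zj _ (@ltxx _)).
right.
have Ssmall x : G x -> ~ ([set: K] #<= S x) by move=> Gx ?; apply: nS; exists x.
(* [c x] codes the turns that [x] takes at the levels in [S x]. *)
pose rho x := collapse wf wf k0 setT (S x).
pose c x := [set l | exists2 k, S x k & rho x k = l /\ B k x].
have Ssmall' x w : G x -> ~ ([set: K] #<= S x `&` [set v | lt v w]).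
  by move=> /Ssmall + KS; apply; apply: card_le_trans KS (subset_card_le _) => ? [].
have GK : G #<= [set: K].
  apply: (@card_le_trans _ _ _
    (\bigcup_(l in [set: K]) [set T | T `<=` [set j | ~ lt l j]])); last first.
    by apply: (bigcup_leK Kinf) => // l _; exact: subsets_leK.
  (* At the first level [k] where [x] and [y] differ, both split, and their
     earlier splitting levels are the same, so [k] has the same rank in both. *)
  have H x y k : G x -> G y -> c x = c y -> (forall j, lt j k -> (B j x <-> B j y)) ->
      B k x -> B k y.
    move=> Gx Gy cxy xy Bkx; apply: contrapT => nBky.
    have Sxk : S x k.
      exists y => //; split=> [j jk|[_ /(_ Bkx)]//].
      by rewrite (xy j jk).
    have Syk : S y k by exists x => //; split=> // -[/(_ Bkx)].
    have e : rho x k = rho y k.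
      apply: collapse_local => // v vk; split=> -[z Gz [zx nz]]; exists z => //; split.
      - by move=> j jv; rewrite (zx j jv) xy//; exact: tr jv vk.
      - by rewrite -(xy v vk).
      - by move=> j jv; rewrite (zx j jv) xy//; exact: tr jv vk.
      - by rewrite (xy v vk).
    have : c x (rho x k) by exists k.
    rewrite cxy e => -[k' Syk' [rk' Bk'y]]; apply: nBky.
    suff <- : k' = k by [].
    by apply: (collapse_inj tri (A := S y) _ Syk' Syk rk') => w _; exact: Ssmall'.
  apply: (card_le_of_inj (f := c)).
    move=> x Gx.
    have [l nl] : exists l, ~ (rho x @` S x) l.
      apply: contrapT => /forallNP nl; apply: (Ssmall x Gx).
      by apply: (card_le_surj (f := rho x)) => l _; apply: contrapT => /nl.
    exists l => // _ [k Sk [<- _]] /= lk; apply: nl.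
    have [v Sv <-] :=
      @collapse_down _ _ lt lt wf wf k0 setT _ _ _ (Ssmall' x k Gx) I lk.
    by exists v.
  move=> x y Gx Gy cxy; apply: B_sep => j.
  elim/(well_founded_induction wf): j => j IH.
  by split; apply: H => // i /IH ->.
pose F0 := [set D `&` cell p.1 p.2 | p in [set p | [/\ D p.1, P (D `&` cell p.1 p.2) &
  forall j, lt j p.2 -> ~ P (D `&` cell p.1 j)]]].
have F0P C : F0 C -> P C /\ (exists x l, C = D `&` cell x l).
  by move=> [[x k] /= [Dx Pxk _] <-]; split=> //; exists x, k.
have F0G C x : F0 C -> G x -> ~ C x.
  move=> [[y k] /= [Dy Pyk _] <-] [Dx nPx] [_ /= xy]; apply: (nPx k).
  by rewrite (cell_eq xy (@ltxx k)).
have F0t C C' : F0 C -> F0 C' -> C `&` C' !=set0 -> C = C'.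
  move=> [[x k] /= [Dx Px mx] <-] [[y l] /= [Dy Py my] <-] [z [[_ zx] [_ zy]]].
  have [kl|kl|kl] := tri k l.
  - by case: (my k kl); rewrite -(cell_eq zy (ltNlt kl)) (cell_eq zx (@ltxx k)).
  - by rewrite -(cell_eq zx (@ltxx k)) kl (cell_eq zy (@ltxx l)).
  - by case: (mx l kl); rewrite -(cell_eq zx (ltNlt kl)) (cell_eq zy (@ltxx l)).
exists (F0 `|` [set [set x] | x in G]); split.
- apply: (setU_leK Kinf); last exact: card_le_trans (card_image_le _ _) GK.
  apply: card_le_trans cells_leK.
  apply: (@card_le_trans _ _ _ ([set D `&` C | C in [set cell p.1 p.2 | p in [set: X * K]]])).
    by apply: subset_card_le => _ [p _ <-]; exists (cell p.1 p.2) => //; exists p.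
  exact: card_image_le.
- by move=> C [/F0P|[x _ <-]]; [left|right; exists x].
- move=> C C' [F0C|[x Gx <-]] [F0C'|[y Gy <-]].
  + exact: F0t.
  + by move=> [z [Cz zy]]; case: (F0G C y) => //; rewrite -zy.
  + by move=> [z [zx C'z]]; case: (F0G C' x) => //; rewrite -zx.
  + by move=> [z [<- <-]].
- apply/seteqP; split=> [x Dx|x [C [[p _ <-] []//|[y [Dy _] <-] ->//]]].
  have [Gx|nG] := pselect (G x); first by exists [set x] => //; right; exists x.
  have [k Pk kmin] : exists2 k, P (D `&` cell x k) &
      forall j, lt j k -> ~ P (D `&` cell x j).
    apply: wf_least => //; apply: contrapT => /forallNP nP; apply: nG; split=> //.
  by exists (D `&` cell x k) => //; left; exists (x, k).
Qed.

End tree.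

(** * Ordinals *)

Lemma ole_or_olt a b : ole a b \/ olt b a.
Proof.
have [|n] := pselect (ole a b); first by left.
by right; apply/oltNge.
Qed.

Lemma olt_osucc a b : olt a (osucc b) <-> ole a b.
Proof. by split=> [[_ //]|ab]; exists tt. Qed.

Lemma osucc_ole a b : ole (osucc a) b <-> olt a b.
Proof.
split=> [|ab]; first by apply: olt_ole_trans; apply/olt_osucc; exact: ole_refl.
by apply/oleP => c /olt_osucc ca; exact: ole_olt_trans ca ab.
Qed.

Lemma olt1_2 : olt oone otwo.
Proof. by apply/olt_osucc; exact: ole_refl. Qed.

(** * The hierarchy *)

Section hierarchy.
Variables (K : Type) (X : topologicalType).
Hypothesis Kinf : infinite_set [set: K].

Local Notation Sigma := (@kSigma K X).
Local Notation Pi := (@kPi K X).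
Local Notation Bor := (@kBor K X).

Lemma kSigma_ge1 a A : Sigma a A -> ole oone a.
Proof. by case/kSigmaP => [[[]]|[/oltW]]. Qed.

Lemma kSigma_bigcup a F : ole oone a -> F #<= [set: K] -> F `<=` Sigma a ->
  Sigma a (\bigcup_(A in F) A).
Proof.
move=> a1 FK Fa; have [a1'|a1'] := ole_or_olt a oone.
  apply: kSigma_open; first by split.
  by apply: bigcup_open => A /Fa /kSigmaP[[] //|[/oltNge]].
have /choice[G GP] : forall A, exists G, F A -> [/\ G #<= [set: K],
    G `<=` \bigcup_(b in [set b | ole oone b /\ olt b a]) Pi b & A = \bigcup_(B in G) B].
  move=> A; have [/Fa/kSigmaP[[[]]|[_ [G ?]]]|nFA] := pselect (F A).
  - by move/oltNge: a1'.
  - by exists G.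
  - by exists set0 => /nFA.
have -> : \bigcup_(A in F) A = \bigcup_(B in \bigcup_(A in F) G A) B.
  apply/seteqP; split=> x.
    move=> [A FA Ax]; have [_ _ AE] := GP A FA; move: Ax; rewrite AE => -[B GB Bx].
    by exists B => //; exists A.
  move=> [B [A FA GB] Bx]; exists A => //; have [_ _ ->] := GP A FA.
  by exists B.
apply: kSigma_union => //.
  by apply: bigcup_leK => // A FA; have [] := GP A FA.
by move=> B [A FA GB]; have [_ /(_ B GB)[b [? ?] ?] _] := GP A FA; exists b.
Qed.

Lemma kSigma_bigcup_fun I a (D : set I) (F : I -> set X) : ole oone a ->
  D #<= [set: K] -> (forall i, D i -> Sigma a (F i)) ->
  Sigma a (\bigcup_(i in D) F i).
Proof.
move=> a1 DK DF; rewrite -(bigcup_image D F id); apply: kSigma_bigcup => //.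
  exact: card_le_trans (card_image_le _ _) DK.
by move=> _ [i Di <-]; exact: DF.
Qed.

Lemma kSigmaU a A B : Sigma a A -> Sigma a B -> Sigma a (A `|` B).
Proof.
move=> aA aB; have -> : A `|` B = \bigcup_(C in [set A; B]) C.
  by rewrite bigcup_setU !bigcup_set1.
apply: kSigma_bigcup; first exact: kSigma_ge1 aA.
  by apply: (setU_leK Kinf); apply: (countable_leK Kinf); exact: countable1.
by move=> C [->|->].
Qed.

Lemma kPi_kSigma a b A : ole oone a -> olt a b -> Pi a A -> Sigma b A.
Proof.
move=> a1 ab aA; rewrite -(bigcup_set1 id A).
apply: kSigma_union; first exact: ole_olt_trans ab.
  by apply: (countable_leK Kinf); exact: countable1.
by move=> _ ->; exists a.
Qed.

Lemma kBor_setC A : Bor A -> Bor (~` A).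
Proof. by move=> BA M HM; have [[MC _] _] := HM; apply: MC; exact: BA HM. Qed.

Lemma kBor_bigcup F : F `<=` Bor -> F #<= [set: K] -> Bor (\bigcup_(A in F) A).
Proof.
by move=> FB FK M HM; have [[_ MU] _] := HM; apply: MU => // A /FB; exact.
Qed.

Lemma kBor_bigcup_fun I (D : set I) (F : I -> set X) :
  D #<= [set: K] -> (forall i, D i -> Bor (F i)) -> Bor (\bigcup_(i in D) F i).
Proof.
move=> DK DF; rewrite -(bigcup_image D F id); apply: kBor_bigcup.
  by move=> _ [i Di <-]; exact: DF.
exact: card_le_trans (card_image_le _ _) DK.
Qed.

Lemma kBor_open A : open A -> Bor A.
Proof. by move=> oA M [_]; exact. Qed.

Lemma kBor_closed A : closed A -> Bor A.
Proof.
by rewrite -openC => oA; rewrite -[A]setCK; apply: kBor_setC; exact: kBor_open.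
Qed.

Lemma kBorU A B : Bor A -> Bor B -> Bor (A `|` B).
Proof.
move=> aA aB; have -> : A `|` B = \bigcup_(C in [set A; B]) C.
  by rewrite bigcup_setU !bigcup_set1.
apply: kBor_bigcup; first by move=> C [->|->].
by apply: (setU_leK Kinf); apply: (countable_leK Kinf); exact: countable1.
Qed.

Lemma kBorI A B : Bor A -> Bor B -> Bor (A `&` B).
Proof.
move=> BA BB; rewrite -[A `&` B]setCK setCI.
by apply: kBor_setC; apply: kBorU; exact: kBor_setC.
Qed.

Lemma kSigma_kBor a A : Sigma a A -> Bor A.
Proof.
elim/(well_founded_induction olt_wf): a A => a IH A.
move=> /kSigmaP[[_]|[_ [F [FK Fa ->]]]]; first exact: kBor_open.
apply: kBor_bigcup => // B /Fa[b [_ ba] /(IH _ ba)/kBor_setC].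
by rewrite setCK.
Qed.

Section regular_weight.
Hypotheses (Xreg : regular_space X) (Xw : weight_le K X).

(** By regularity, an open set is the union of the closures of the basic open sets
    whose closure it contains.  This is what makes the hierarchy increasing. *)
Lemma open_kSigma a A : olt oone a -> open A -> Sigma a A.
Proof.
move=> a1 oA; have [Bs [Bo Bn] BK] := Xw.
pose F := [set closure U | U in [set U | Bs U /\ closure U `<=` A]].
have -> : A = \bigcup_(C in F) C.
  apply/seteqP; split=> x; last by move=> [_ [U [_ UA] <-]]; exact: UA.
  move=> Ax; have [V Vx VA] := Xreg (open_nbhs_nbhs (conj oA Ax)).
  have [U [BU Ux] UV] := Bn x V Vx.
  have UA : closure U `<=` A by apply: subset_trans VA; exact: closure_subset.
  by exists (closure U); [exists U|exact: subset_closure].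
apply: kSigma_union => //.
  apply: card_le_trans (card_image_le _ _) (card_le_trans _ BK).
  by apply: subset_card_le => U [].
move=> _ [U _ <-]; exists oone; split=> //; first exact: ole_refl.
by apply: kSigma_open; [split; exact: ole_refl|rewrite openC; exact: closed_closure].
Qed.

Lemma kSigma_mono a b A : ole a b -> Sigma a A -> Sigma b A.
Proof.
move=> ab /kSigmaP[[[a1 ?] oA]|[a1 [F [FK Fa ->]]]].
  have [b1|b1] := ole_or_olt b oone; last exact: open_kSigma.
  by apply: kSigma_open => //; split=> //; apply: ole_trans ab.
apply: kSigma_union => //; first exact: olt_ole_trans ab.
by move=> B /Fa[c [? ca] ?]; exists c; split=> //; exact: olt_ole_trans ab.
Qed.

Lemma kSigmaI a A B : Sigma a A -> Sigma a B -> Sigma a (A `&` B).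
Proof.
move=> /[dup]/kSigma_ge1 a1.
have [a1'|a1'] := ole_or_olt a oone.
  move=> /kSigmaP[[_ oA]|[/oltNge//]] /kSigmaP[[_ oB]|[/oltNge//]].
  by apply: kSigma_open => //; exact: openI.
move=> /kSigmaP[[[]]|[_ [F [FK Fa ->]]]]; first by move/oltNge: a1'.
move=> /kSigmaP[[[]]|[_ [G [GK Ga ->]]]]; first by move/oltNge: a1'.
rewrite setI_bigcupl; apply: kSigma_bigcup_fun => // C /Fa[c [c1 ca] cC].
rewrite setI_bigcupr; apply: kSigma_bigcup_fun => // D /Ga[d [d1 da] dD].
have [cd|/oltW dc] := ole_or_olt c d.
  apply: (kPi_kSigma d1 da); rewrite /kPi/= setCI; apply: kSigmaU => //.
  exact: kSigma_mono cC.
apply: (kPi_kSigma c1 ca); rewrite /kPi/= setCI; apply: kSigmaU => //.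
exact: kSigma_mono dD.
Qed.

Lemma kPi_bigcap I a (D : set I) (F : I -> set X) : ole oone a ->
  D #<= [set: K] -> (forall i, D i -> Pi a (F i)) -> Pi a (\bigcap_(i in D) F i).
Proof. by move=> a1 DK DF; rewrite /kPi/= setC_bigcap; exact: kSigma_bigcup_fun. Qed.

Lemma kSigma_closed a A : olt oone a -> closed A -> Sigma a A.
Proof.
move=> a1 cA; apply: (kPi_kSigma (ole_refl _) a1); apply: kSigma_open.
  by split; exact: ole_refl.
by rewrite openC.
Qed.

Hypothesis Xhd : hausdorff_space X.

(** * Complexity of Borel subsets of a piece *)

(** For [D] in [Sigma b] this says that the relative hierarchy on [D] has reached
    all its Borel sets at stage [b]; stating it with sets of the whole space
    dispenses with subspaces. *)
Definition simple_at (D : set X) b := forall A, Bor A -> Sigma b (A `&` D).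

Lemma simple_mono D b c : ole b c -> simple_at D b -> simple_at D c.
Proof. by move=> bc Db A /Db; exact: kSigma_mono. Qed.

Lemma simple_subset D E b : Bor E -> E `<=` D -> simple_at D b -> simple_at E b.
Proof.
move=> BE ED Db A BA; have -> : A `&` E = A `&` E `&` D.
  by rewrite -setIA; congr (_ `&` _); apply/esym/setIidPl.
by apply: Db; exact: kBorI.
Qed.

Lemma kBorT : Bor setT.
Proof. by apply: kBor_open; exact: openT. Qed.

Lemma simple_kSigma D b : simple_at D b -> Sigma b D.
Proof. by move=> /(_ _ kBorT); rewrite setTI. Qed.

Lemma simple_bigcup I (J : set I) (D : I -> set X) b : ole oone b -> J #<= [set: K] ->
  (forall i, J i -> simple_at (D i) b) -> simple_at (\bigcup_(i in J) D i) b.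
Proof.
move=> b1 JK Db A BA; rewrite setI_bigcupr.
by apply: kSigma_bigcup_fun => // i /Db; exact.
Qed.

Lemma simple_set1 x b : olt oone b -> simple_at [set x] b.
Proof.
move=> b1 A _; apply: kSigma_closed => //.
have [Ax|nAx] := pselect (A x).
  have -> : A `&` [set x] = [set x] by apply/setIidPr => _ ->.
  exact: (accessible_closed_set1 (hausdorff_accessible Xhd)).
have -> : A `&` [set x] = set0 by apply/seteqP; split=> // y [Ay yx]; rewrite yx in Ay.
exact: closed0.
Qed.

(** For an open family [B], the cells are intersections of open and closed sets, hence
    [Sigma othree]; from this level on, intersecting with a cell keeps the
    class. *)
Definition othree := osucc otwo.

(** One Borel set witnesses, for all levels at once, that [D] is not simple.  At a
    limit level this is much more than the existence of a witness for each
    smaller level. *)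
Definition tame (D : set X) := exists2 A, Bor A &
  forall b, ole othree b -> Sigma b (A `&` D) -> simple_at D b.

Lemma olt1_3 : olt oone othree.
Proof. by apply/olt_osucc/oltW; exact: olt1_2. Qed.

Lemma tame_simple3 D : simple_at D othree -> tame D.
Proof. by move=> D3; exists setT; [exact: kBorT|move=> b b3 _; exact: simple_mono D3]. Qed.

(** The union of the witnesses is a witness: its trace on each piece returns the
    witness of that piece, so every piece, hence the union, is simple at any level
    that the union of the witnesses attains. *)
Lemma tame_bigcup (F : set (set X)) : F #<= [set: K] -> F `<=` Sigma othree ->
  F `<=` tame -> (forall C C', F C -> F C' -> C `&` C' !=set0 -> C = C') ->
  tame (\bigcup_(C in F) C).
Proof.
move=> FK F3 Ft Fd.
have /choice[A AP] : forall C, exists A, F C -> Bor A /\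
    forall b, ole othree b -> Sigma b (A `&` C) -> simple_at C b.
  move=> C; have [/Ft[A BA AP]|nFC] := pselect (F C); first by exists A.
  by exists set0 => /nFC.
exists (\bigcup_(C in F) (A C `&` C)).
  apply: kBor_bigcup_fun => // C FC; apply: kBorI; first by have [] := AP C FC.
  exact: kSigma_kBor (F3 _ FC).
move=> b b3 Ab; apply: simple_bigcup => // [|C FC].
  exact: ole_trans (oltW olt1_3) b3.
have [_] := AP C FC; apply=> //.
suff -> : A C `&` C = (\bigcup_(C in F) (A C `&` C)) `&` (\bigcup_(C in F) C) `&` C.
  by apply: kSigmaI => //; exact: kSigma_mono b3 (F3 _ FC).
apply/seteqP; split=> x [].
  by move=> Ax Cx; split=> //; split; exists C.
move=> [[C' FC' [AC' C'x] _]] Cx; have CC' : C = C' by apply: Fd => //; exists x.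
by rewrite CC' in Cx *; split.
Qed.

(** Diagonalisation: since [lam] is below the successor cardinal of [K], the
    ordinals [b < lam] can be listed along [K], and the [k]-th piece is used to
    escape from the [k]-th of them. *)
Lemma tame_antichain lam D (W : K -> set X) : olt lam (kplus K) -> simple_at D lam ->
  (forall k, W k `<=` D) -> (forall k, Sigma othree (W k)) ->
  (forall j k, W j `&` W k !=set0 -> j = k) ->
  (forall k b, olt b lam -> ~ simple_at (W k) b) -> tame D.
Proof.
move=> lamK Dlam WD W3 Wd Wn.
have [k0 _] := infinite_setN0 Kinf.
have [e eP] := (olt_kplusP lam (inhabits k0)).1 lamK.
have /choice[A AP] : forall k, exists A, Bor A /\
    (olt (e k) lam -> ~ Sigma (e k) (A `&` W k)).
  move=> k; have [/(Wn k)/existsNP[A /not_implyP[BA nA]]|nk] := pselect (olt (e k) lam).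
    by exists A.
  by exists setT; split=> [|/nk//]; exact: kBorT.
exists (\bigcup_k (A k `&` W k)).
  apply: kBor_bigcup_fun => // k _; apply: kBorI; first by have [] := AP k.
  exact: kSigma_kBor (W3 k).
move=> b b3 Ab; have [lamb|blam] := ole_or_olt lam b; first exact: simple_mono Dlam.
have [k [bk kb]] := eP b blam; have [_ nAk] := AP k.
have []// := nAk (ole_olt_trans kb blam); apply: kSigma_mono bk _.
suff -> : A k `&` W k = (\bigcup_k (A k `&` W k)) `&` D `&` W k.
  by apply: kSigmaI => //; exact: kSigma_mono b3 (W3 _).
apply/seteqP; split=> x [].
  by move=> Ax Wx; split=> //; split; [exists k|exact: WD Wx].
by move=> [[j _ [Aj Wj]] _] Wk; have <- : j = k by apply: Wd; exists x.
Qed.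

(** A base listed along [K]; indices that code no basic set receive [setT]. *)
Lemma base_family : exists B : K -> set X, (forall k, open (B k)) /\
  forall x U, open U -> U x -> exists k, B k x /\ B k `<=` U.
Proof.
have [Bs [Bo Bn] BK] := Xw.
have [g _ ginj] := card_le_inj BK (infinite_setN0 Kinf).
have /choice[B BP] : forall k, exists U, open U /\ forall V, Bs V -> g V = k -> V = U.
  move=> k; have [[V BV Vk]|nV] := pselect (exists2 V, Bs V & g V = k).
    exists V; split=> [|V' BV' V'k]; first exact: Bo.
    by apply: ginj => //; rewrite Vk.
  by exists setT; split=> [|V BV Vk]; [exact: openT|case: nV; exists V].
exists B; split=> [k|x U oU Ux]; first by have [] := BP k.
have [V [BV Vx] VU] := Bn x U (open_nbhs_nbhs (conj oU Ux)).
by exists (g V); have [_ /(_ V BV erefl) <-] := BP (g V).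
Qed.

Hypothesis Kpow : is_weak_power K K.

(** Every piece is tame.  By induction, a non-tame cell of [D] is simple at no level
    below [lam].  Applied to tameness, the dichotomy for the tree of cells gives
    either [K] disjoint cells of this kind, to diagonalise against, or a partition
    of [D] into tame pieces. *)
Lemma simple_tame lam D : olt lam (kplus K) -> Sigma othree D -> simple_at D lam ->
  tame D.
Proof.
elim/(well_founded_induction olt_wf): lam D => lam IH D lamK D3 Dlam.
have [lt wo lt_init] := initial_wo Kinf.
have [B [Bo Bb]] := base_family.
have Bsep x y : (forall j, B j x <-> B j y) -> x = y.
  move=> xy; apply: contrapT => /eqP nxy.
  have := Xhd; rewrite open_hausdorff => /(_ _ _ nxy)[[U V] /= [Ux Vy] [oU oV UV]].
  have [k [Bx BU]] := Bb x U oU (set_mem Ux).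
  have : (U `&` V) y by split; [apply: BU; apply/xy|exact: set_mem].
  by move/eqP: UV => ->.
have B3 x k : Sigma othree (cell lt B x k).
  apply: (@kPi_kSigma otwo); [exact: oltW olt1_2|exact/olt_osucc/ole_refl|].
  have -> : cell lt B x k = \bigcap_(j in [set j | ~ lt k j])
      [set y | B j y <-> B j x].
    by apply/seteqP; split=> y; exact.
  apply: kPi_bigcap; [exact: oltW olt1_2|exact: card_leT|move=> j _].
  have [Bx|nBx] := pselect (B j x).
    have -> : [set y | B j y <-> B j x] = B j.
      by apply/seteqP; split=> y /=; [case=> _; apply|].
    rewrite /kPi/=; apply: kSigma_closed; first exact: olt1_2.
    exact: open_closedC.
  have -> : [set y | B j y <-> B j x] = ~` B j.
    apply/seteqP; split=> y /=; first by move=> [+ _] => /[apply].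
    by move=> nBy; split=> [/nBy|/nBx].
  by rewrite /kPi/= setCK; apply: open_kSigma => //; exact: olt1_2.
have [] := cell_dichotomy Kinf Kpow wo lt_init Bsep tame D.
  move=> [W [Wc nW Wd]].
  have W3 k : Sigma othree (W k).
    by have [x [l ->]] := Wc k; exact: kSigmaI.
  have WD k : W k `<=` D by have [x [l ->]] := Wc k; exact: subIsetl.
  apply: (tame_antichain lamK Dlam WD W3 Wd) => k b blam Wb.
  apply: (nW k); apply: (IH b) => //.
  exact: olt_ole_trans (oltW lamK).
move=> [F [FK FP Fd ->]]; apply: tame_bigcup => //.
  move=> C /FP[[_ [x [l ->]]]|[x ->]]; first exact: kSigmaI.
  by apply: simple_kSigma; apply: simple_set1; exact: olt1_3.
move=> C /FP[[]//|[x ->]]; apply: tame_simple3; apply: simple_set1; exact: olt1_3.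
Qed.

(** * Sets that are new at the level of the order *)

Lemma simple_setT a : Sigma a = Bor <-> simple_at [set: X] a.
Proof.
split=> [aB A BA|aB]; first by rewrite setIT aB.
apply/seteqP; split=> A; first exact: kSigma_kBor.
by move=> /aB; rewrite setIT.
Qed.

Lemma new_kDeltaP a : Sigma a = Bor -> new_kDelta K X a <->
  exists2 A, Bor A & forall b, olt b a -> ~ Sigma b A /\ ~ Sigma b (~` A).
Proof.
move=> aB; split=> [[A [[aA _] nA]]|[A BA nA]].
  exists A => [|b ba]; first by rewrite -aB.
  by split=> bA; apply: nA; exists b; [split=> //; exact: kSigma_ge1 bA|left|
    split=> //; exact: kSigma_ge1 bA|right].
exists A; split.
  by split; [rewrite aB|rewrite /kPi/= aB; exact: kBor_setC].
by move=> [b [_ /nA[nA1 nA2]] []].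
Qed.

(** At a limit the witness of tameness for [X] itself is new: it is in no earlier
    [Sigma] class, and an earlier [Pi] class is contained in the next [Sigma]
    class, which is still earlier. *)
Lemma new_kDelta_limit a : is_kord K X a -> olt a (kplus K) ->
  (forall b, olt b a -> olt (osucc b) a) -> new_kDelta K X a.
Proof.
move=> [a1 aB amin] aK alim; apply/(new_kDeltaP aB).
have a0 : olt ozero a by exact/osucc_ole.
have a3 : olt othree a by exact: alim (alim _ (alim _ a0)).
have [A BA tA] : tame [set: X].
  apply: (simple_tame aK); last exact/simple_setT.
  by apply: open_kSigma; [exact: olt1_3|exact: openT].
have nA b : olt b a -> ~ Sigma b A.
  move=> ba bA; have [c [bc c3 ca]] : exists c, [/\ ole b c, ole othree c & olt c a].
    have [b3|/oltW b3] := ole_or_olt b othree; first by exists othree; split=> //; exact: ole_refl.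
    by exists b; split=> //; exact: ole_refl.
  move/oltNge: ca; apply; apply: amin; first exact: ole_trans (oltW olt1_3) c3.
  by apply/simple_setT/tA => //; rewrite setIT; exact: kSigma_mono bc bA.
exists A => // b ba; split=> [/nA|bA]; first exact.
apply: (nA (osucc b)); first exact: alim.
by apply: (kPi_kSigma (kSigma_ge1 bA)) bA; apply/olt_osucc; exact: ole_refl.
Qed.

Lemma hausdorff_sep (x y : X) : x <> y -> exists U V,
  [/\ open U, open V, U x, V y & U `&` V = set0].
Proof.
move=> /eqP; have := Xhd; rewrite open_hausdorff => + xy => /(_ _ _ xy).
move=> [[U V] /= [/set_mem Ux /set_mem Vy] [oU oV /eqP UV]].
by exists U, V.
Qed.

(** Let [U0] be the union of the basic open sets that are simple at [g].  If its
    complement had at most one point, [X] would be simple at [g], as singletons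
    are.  So two points lie outside [U0]; in disjoint neighbourhoods of them,
    a set that is not [Sigma g] and the complement of one combine to a set that
    is neither [Sigma g] nor [Pi g]. *)
Lemma new_kDelta_succ g a : ole otwo g -> olt g a ->
  (forall b, olt b a -> ole b g) -> is_kord K X a -> new_kDelta K X a.
Proof.
move=> g2 ga ag [_ aB amin]; apply/(new_kDeltaP aB).
have g1 : olt oone g by exact: olt_ole_trans olt1_2 g2.
have nT : ~ simple_at [set: X] g.
  by move=> /simple_setT /(amin _ (oltW g1)); exact/oltNge.
have [B [Bo Bb]] := base_family.
pose J := [set k | simple_at (B k) g]; pose U0 := \bigcup_(k in J) B k.
have U0g : simple_at U0 g by apply: simple_bigcup; [exact: oltW|exact: card_leT|].
have hard x U : ~ U0 x -> open U -> U x -> exists2 A, Bor A & ~ Sigma g (A `&` U).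
  move=> U0x oU Ux; apply: contrapT => nA.
  have [k [Bx BU]] := Bb x U oU Ux; apply: U0x; exists k => //.
  apply: simple_subset BU _; first exact: kBor_open.
  by move=> A BA; apply: contrapT => nAU; apply: nA; exists A.
have [x [y [xy nx ny]]] : exists x y, [/\ x <> y, ~ U0 x & ~ U0 y].
  apply: contrapT => none; apply: nT => A BA.
  have AU0 := U0g A BA.
  have [[x nx]|allx] := pselect (exists x, ~ U0 x).
    have -> : A `&` setT = (A `&` U0) `|` (A `&` [set x]).
      rewrite -setIUr; congr (_ `&` _); apply/seteqP; split=> // y _.
      have [|ny] := pselect (U0 y); [by left|right=> /=].
      by apply: contrapT => yx; apply: none; exists y, x.
    by apply: kSigmaU => //; apply: simple_set1.
  have <- : U0 = setT; last by [].
  by apply/seteqP; split=> // x _; apply: contrapT => nx; apply: allx; exists x.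
have [U [V [oU oV Ux Vy UV]]] := hausdorff_sep xy.
have [A BA nA] := hard x U nx oU Ux.
have [C BC nC] := hard y V ny oV Vy.
have nUV z : U z -> V z -> False.
  by move=> Uz Vz; have : (U `&` V) z by []; rewrite UV.
have IU : (A `&` U `|` (V `\` C)) `&` U = A `&` U.
  apply/seteqP; split=> z [].
    by move=> [//|[Vz _]] /nUV/(_ Vz).
  by move=> Az Uz; split=> //; left.
have IV : ~` (A `&` U `|` (V `\` C)) `&` V = C `&` V.
  apply/seteqP; split=> z [].
    move=> nz Vz; split=> //; apply: contrapT => nCz; apply: nz; right; split=> //.
  by move=> Cz Vz; split=> // -[[_ /nUV/(_ Vz)]|[_]].
exists (A `&` U `|` (V `\` C)).
  apply: kBorU; apply: kBorI => //; [exact: kBor_open|exact: kBor_open|exact: kBor_setC].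
move=> b /ag bg; split=> /(kSigma_mono bg) gA.
  by apply: nA; rewrite -IU; apply: kSigmaI => //; exact: open_kSigma.
by apply: nC; rewrite -IV; apply: kSigmaI => //; exact: open_kSigma.
Qed.

Lemma isolatedTP (x : X) : isolated [set: X] x <-> open [set x].
Proof.
split=> [[_ [V Vx]]|ox].
  rewrite setIT => Ve; rewrite Ve in Vx.
  by rewrite openE => y /= ->.
split; first exact/mem_set.
by exists [set x]; [exact: open_nbhs_nbhs|rewrite setIT].
Qed.

Lemma not_isolatedP (x : X) U : ~ isolated [set: X] x -> open U -> U x ->
  exists2 z, U z & z <> x.
Proof.
move=> nx oU Ux; apply: contrapT => nz; apply: nx; apply/isolatedTP.
suff <- : U = [set x] by [].
apply/seteqP; split=> [z Uz|_ -> //]; apply: contrapT => zx; apply: nz.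
by exists z.
Qed.

Lemma kSigma_le1_open b A : olt b otwo -> Sigma b A -> open A.
Proof.
move=> /olt_osucc b1 /kSigmaP[[]//|[]].
by move/oltNge.
Qed.

(** The set [(U minus x) + y], with [U] around [x] away from [y], is not open at [y]
    and not closed at [x]. *)
Lemma new_kDelta_two a x y : oeq a otwo -> Sigma a = Bor ->
  x <> y -> ~ isolated [set: X] x -> ~ isolated [set: X] y -> new_kDelta K X a.
Proof.
move=> [a2 _] aB xy nx ny; apply/(new_kDeltaP aB).
have [U [V [oU oV Ux Vy UV]]] := hausdorff_sep xy.
have clo (z : X) : closed [set z].
  exact: (accessible_closed_set1 (hausdorff_accessible Xhd)).
have nUV z : U z -> V z -> False.
  by move=> Uz Vz; have : (U `&` V) z by []; rewrite UV.
exists (U `\` [set x] `|` [set y]).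
  apply: kBorU; last exact: kBor_closed.
  by apply: kBor_open; apply: openI => //; rewrite openC.
move=> b ba; have b2 := olt_ole_trans ba a2; split=> /(kSigma_le1_open b2) oA.
  have [|z [Vz zA] zy] := not_isolatedP ny (openI oV oA).
    by split=> //; right.
  by case: zA => [[Uz _]|//]; exact: nUV Uz Vz.
have [|z [Uz nz] zx] := not_isolatedP nx (openI oU oA).
  by split=> // -[[_ []]|].
by apply: nz; left.
Qed.

Lemma kord_gt1 a x : is_kord K X a -> ~ isolated [set: X] x -> olt oone a.
Proof.
move=> [a1 aB _] nx; have [a1'|//] := ole_or_olt a oone; exfalso; apply: nx.
apply/isolatedTP.
have : Sigma a [set x].
  rewrite aB; apply: kBor_closed.
  exact: (accessible_closed_set1 (hausdorff_accessible Xhd)).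
by move/(kSigma_le1_open (ole_olt_trans a1' olt1_2)).
Qed.

(** Every set that misses the only non-isolated point is open, and either a set or
    its complement misses it. *)
Lemma not_new_kDelta a : is_kord K X a -> (exists! x : X, ~ isolated [set: X] x) ->
  ~ new_kDelta K X a.
Proof.
move=> ak [x [nx ux]]; have a1 := kord_gt1 ak nx; have [_ aB _] := ak.
move=> /(new_kDeltaP aB)[A _ /(_ oone a1)]; rewrite kSigma_one.
have opn C : ~ C x -> open C.
  move=> nCx; have -> : C = \bigcup_(z in C) [set z].
    by apply/seteqP; split=> [z Cz|z [_ Cz ->]//]; exists z.
  apply: bigcup_open => z Cz; apply/isolatedTP; apply: contrapT => /ux xz.
  by apply: nCx; rewrite xz.
have [Ax [_ nA]|/opn oA [+ _]] := pselect (A x); last exact.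
by apply: nA; apply: opn; exact.
Qed.

Lemma new_kDelta_iff a : is_kord K X a -> olt a (kplus K) ->
  (new_kDelta K X a <-> ~ (exists! x : X, ~ isolated [set: X] x)) /\
  (~ oeq a otwo -> new_kDelta K X a).
Proof.
move=> ak aK; have [a1 aB amin] := ak.
have new_a : ~ oeq a otwo -> new_kDelta K X a.
  move=> na2; have [alim|] := pselect (forall b, olt b a -> olt (osucc b) a).
    exact: new_kDelta_limit.
  move=> /existsNP[g /not_implyP[ga nga]].
  have ag b : olt b a -> ole b g.
    have [aSg|//] := ole_or_olt a (osucc g).
    by move=> ba; apply/olt_osucc; exact: olt_ole_trans ba aSg.
  have [g2|g2] := ole_or_olt otwo g; first exact: new_kDelta_succ ga ag ak.
  have a2 : olt a otwo.
    have [a2|//] := ole_or_olt otwo a; case: na2; split=> //.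
    by apply/oleP => b /ag bg; exact: ole_olt_trans bg g2.
  have nS b A : olt b a -> ~ Sigma b A.
    move=> ba /kSigma_ge1; apply/oltNge; apply: olt_ole_trans ba _.
    exact/olt_osucc.
  apply/(new_kDeltaP aB); exists setT; first exact: kBorT.
  by move=> b ba; split; exact: nS.
split=> //; split=> [new ex1|nex1]; first exact: not_new_kDelta ak ex1 new.
have [a2|/new_a//] := pselect (oeq a otwo).
have [iso|/existsNP[x nx]] := pselect (forall x : X, isolated [set: X] x).
  exfalso; have /oltNge := olt1_2; apply; apply: ole_trans a2.2 _.
  apply: amin; first exact: ole_refl.
  apply/seteqP; split=> A; first exact: kSigma_kBor.
  move=> _; rewrite kSigma_one; have -> : A = \bigcup_(z in A) [set z].
    by apply/seteqP; split=> [z Az|z [_ Az ->]//]; exists z.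
  by apply: bigcup_open => z _; exact/isolatedTP.
have [y [xy ny]] : exists y, x <> y /\ ~ isolated [set: X] y.
  apply: contrapT => none; apply: nex1; exists x; split=> // y ny.
  by apply: contrapT => xy; apply: none; exists y.
exact: new_kDelta_two aB xy nx ny.
Qed.

End regular_weight.
End hierarchy.

Theorem corollary4p6 (K : Type) (K_uncountable : ~ countable [set: K])
    (K_weak_power : is_weak_power K K)
    (X : topologicalType) (X_nonempty : [set: X] !=set0)
    (X_regular : regular_space X) (X_hausdorff : hausdorff_space X)
    (X_weight : weight_le K X)
    (a : Ord) (a_kord : is_kord K X a) (a_lt : olt a (kplus K)) :
  (new_kDelta K X a <-> ~ (exists! x : X, ~ isolated [set: X] x)) /\
  (~ oeq a otwo -> new_kDelta K X a).
Proof.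
apply: new_kDelta_iff => //.
by move=> Kfin; apply: K_uncountable; exact: finite_set_countable.
Qed.
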